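(* Let an instance of a multi-objective integer linear programme $\min\{(z_1(x),\dots,z_p(x))=Cx : x\in X\}$ with outcome set $Y=\{Cx:x\in X\}$ be given, and let $Y_M=\{m^1,\dots,m^p\}$ be the set of dummy points. Consider the algorithm Dummy\_Dichotomy described in the context. Then the algorithm generates only supported nondominated points, and at termination the set $S$ contains the set of all nondominated extreme points of $\operatorname{conv} Y$.
   Context: Setting. $p\ge 2$, $C\in\mathbb{R}^{p\times n}$, $X=\{x\in\mathbb{Z}^n: Ax=b,\ x\geqq 0\}$ with $A\in\mathbb{R}^{m\times n}$, $b\in\mathbb{R}^m$ (all data integer), $z(x)=Cx$, $Y=\{Cx:x\in X\}$. Standing assumptions: no feasible solution minimizes all objectives simultaneously; the ideal point $y^I$, $y^I_k=\min_{x\in X}z_k(x)$, exists and $y^I_k>0$ for all $k$; $\operatorname{conv}Y$ is a polytope. Orders on $\mathbb{R}^p$: $y^1\leqq y^2$ if $y^1_k\le y^2_k$ for all $k$; $y^1\le y^2$ if $y^1\leqq y^2$ and $y^1\ne y^2$. $\mathbb{R}^p_>$ is the set of vectors with all components strictly positive. A point $y\in Y$ is nondominated if there is no $y'\in Y$ with $y'\le y$. It is a supported nondominated point if $y=z(x)$ for an optimal solution $x$ of the weighted sum problem $\min\{\lambda^Tz(x):x\in X\}$ for some $\lambda\in\mathbb{R}^p_>$. The nondominated extreme points are the supported nondominated points that are vertices of $\operatorname{conv}Y$. A face $F$ of a $p$-dimensional polytope $P$ is nondominated if no point of $F$ is dominated by a point of $P$ (i.e. for every $y\in F$ there is no $y'\in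 P$ with $y'\le y$); a facet is nondominated if and only if its normal vectors pointing to the interior of $P$ have all components strictly positive. Dummy points: $m^q=Me_q$, $q=1,\dots,p$, where $e_q$ is the $q$-th unit vector and $M>0$ is a constant chosen large enough that all nondominated extreme points of $\operatorname{conv}Y$ remain nondominated extreme points of $\operatorname{conv}(Y\cup Y_M)$; $Y_M=\{m^1,\dots,m^p\}$. Algorithm Dummy\_Dichotomy. Initialize $S$ with one supported nondominated point. Repeat the following until all nondominated facets of $\operatorname{conv}(S\cup Y_M)$ have been explored: (i) compute/update $\operatorname{conv}(S\cup Y_M)$; (ii) choose any unexplored facet $F$ of $\operatorname{conv}(S\cup Y_M)$ other than the facet $\operatorname{conv}\{m^1,\dots,m^p\}$, and let $\lambda$ be its normal vector pointing to the interior; (iii) solve the weighted sum problem $\min\{\lambda^Tz(x):x\in X\}$, let $x$ be the optimal solution found, $y=z(x)$, and let $y'$ be a point of $F$; (iv) if $\lambda^Ty'=\lambda^Ty$, then $F$ is (a part of) a facet of the convex hull of the union of $Y_M$ with the nondominated extreme points of $\operatorname{conv}Y$, and is marked explored; otherwise $y$ is added to $S$. *)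

(* Defs.v *)
From HB Require Import structures.
From mathcomp Require Export all_boot all_order all_algebra.
From mathcomp Require Export boolp classical_sets cardinality reals.

Set Implicit Arguments.
Unset Strict Implicit.
Unset Printing Implicit Defensive.

Import Order.TTheory GRing.Theory Num.Theory.
Local Open Scope classical_set_scope.
Local Open Scope ring_scope.

Section Polytopes.
Variables (R : realType) (p : nat).
Implicit Types (P F A : set 'cV[R]_p) (lam v y : 'cV[R]_p).

Definition dot (u v : 'cV[R]_p) : R := (u^T *m v) 0 0.

Definition conv A : set 'cV[R]_p :=
  [set y | exists (k : nat) (w : 'I_k -> R) (a : 'I_k -> 'cV[R]_p),
     [/\ forall i, A (a i), forall i, 0 <= w i,
         \sum_i w i = 1 & y = \sum_i w i *: a i]].

Definition polytope P := exists V : set 'cV[R]_p, finite_set V /\ P = conv V.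

Definition affinely_independent (k : nat) (a : 'I_k -> 'cV[R]_p) :=
  forall w : 'I_k -> R,
    \sum_i w i = 0 -> \sum_i w i *: a i = 0 -> forall i, w i = 0.

(* Dimension of the affine hull; no [d] qualifies when [A] is empty. *)
Definition has_dim A (d : nat) :=
  (exists a : 'I_d.+1 -> 'cV[R]_p,
     (forall i, A (a i)) /\ affinely_independent a) /\
  (forall (e : nat) (a : 'I_e.+1 -> 'cV[R]_p),
     (forall i, A (a i)) -> affinely_independent a -> (e <= d)%N).

Definition face P F :=
  exists (lam : 'cV[R]_p) (c : R),
    (forall y, P y -> c <= dot lam y) /\ F = [set y | P y /\ dot lam y = c].

Definition facet P F :=
  face P F /\ exists d : nat, has_dim P d.+1 /\ has_dim F d.

(* A 0-dimensional face. *)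
Definition vertex P v := face P [set v].

(* For a facet [F] of a full-dimensional [P], this determines [lam] up to a
   positive factor. *)
Definition inward_normal P F lam :=
  lam != 0 /\
  exists c : R, (forall y, F y -> dot lam y = c) /\
                (forall y, P y -> c <= dot lam y).

End Polytopes.

Section Dominance.
Variables (R : realType) (p : nat).
Implicit Types (Q P F : set 'cV[R]_p) (y lam : 'cV[R]_p).

Definition leqq y1 y2 := forall k, y1 k 0 <= y2 k 0.

Definition dominates y1 y2 := leqq y1 y2 /\ y1 <> y2.

Definition positive lam := forall k, 0 < lam k 0.

Definition nondominated Q y := Q y /\ ~ exists y', Q y' /\ dominates y' y.

(* The outcome set [Q] is arbitrary because the notion is needed for [Y] and
   for [Y] extended by the dummy points; [supported_nondominatedE] below spells
   it out with optimal solutions of the weighted sum problem. *)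
Definition supported_nondominated Q y :=
  nondominated Q y /\
  exists lam, positive lam /\ forall y', Q y' -> dot lam y <= dot lam y'.

Definition nondominated_extreme Q y :=
  supported_nondominated Q y /\ vertex (conv Q) y.

Definition nondominated_face P F := forall y, F y -> nondominated P y.

End Dominance.

Record moilp (p m n : nat) := Moilp {
  objective : 'M[int]_(p, n);
  lhs : 'M[int]_(m, n);
  rhs : 'cV[int]_m }.

Section Instance.
Variables (R : realType) (p m n : nat) (I : moilp p m n).
Implicit Types (x : 'cV[int]_n) (lam yI : 'cV[R]_p).

Definition feasible : set 'cV[int]_n :=
  [set x | lhs I *m x = rhs I /\ forall j, 0 <= x j 0].

Definition outcome x : 'cV[R]_p := map_mx intr (objective I *m x).

Definition outcomes : set 'cV[R]_p := [set outcome x | x in feasible].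

Definition weighted_sum_optimal lam x :=
  feasible x /\
  forall x', feasible x' -> dot lam (outcome x) <= dot lam (outcome x').

Definition simultaneous_minimizer x :=
  feasible x /\ forall k x', feasible x' -> outcome x k 0 <= outcome x' k 0.

Definition ideal_point yI :=
  forall k, (exists x, feasible x /\ outcome x k 0 = yI k 0) /\
            (forall x, feasible x -> yI k 0 <= outcome x k 0).

Lemma supported_nondominatedE y :
  supported_nondominated outcomes y <->
  nondominated outcomes y /\
  exists lam x, [/\ positive lam, weighted_sum_optimal lam x & y = outcome x].
Proof.
split=> -[ndy].
  have [[x Xx zx] _] := ndy; case=> lam [lam_gt0 le_y]; split=> //.
  exists lam, x; split=> //; split=> // x' Xx'; rewrite zx.
  by apply: le_y; exists x'.
case=> lam [x [lam_gt0 [Xx le_x] yx]]; split=> //.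
by exists lam; split=> // _ [x' Xx' <-]; rewrite yx; apply: le_x.
Qed.

End Instance.

Arguments outcome R {p m n} I x.
Arguments outcomes R {p m n} I _.
Arguments simultaneous_minimizer R {p m n} I x.

Section Dummy.
Variables (R : realType) (p : nat) (M : R).

Definition dummy (q : 'I_p) : 'cV[R]_p := M *: delta_mx q 0.

Definition dummies : set 'cV[R]_p := range dummy.

Definition large_enough (Y : set 'cV[R]_p) :=
  0 < M /\
  forall y, nondominated_extreme Y y ->
            nondominated_extreme (Y `|` dummies) y.

End Dummy.

Section DummyDichotomy.
Variables (R : realType) (p m n : nat) (I : moilp p m n) (M : R).
Implicit Types (S F : set 'cV[R]_p) (E : set (set 'cV[R]_p)).

Record dd_state := DDState {
  found : set 'cV[R]_p;
  explored : set (set 'cV[R]_p) }.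

Definition dd_hull S := conv (S `|` dummies M).

Definition dd_terminated (s : dd_state) :=
  forall F, facet (dd_hull (found s)) F ->
            nondominated_face (dd_hull (found s)) F -> explored s F.

Definition dd_initial (s : dd_state) :=
  exists y, supported_nondominated (outcomes R I) y /\
            s = DDState [set y] set0.

(* [dd_select s F lam x]: in state [s], the iteration picks the facet [F] with
   normal [lam], and [x] is returned by the weighted sum problem. *)
Definition dd_select (s : dd_state) F (lam : 'cV[R]_p) (x : 'cV[int]_n) :=
  [/\ ~ dd_terminated s,
      [/\ facet (dd_hull (found s)) F, F <> conv (dummies M)
        & ~ explored s F],
      inward_normal (dd_hull (found s)) F lam
    & weighted_sum_optimal I lam x].

(* One iteration, labelled by the outcome computed in it. The facet, the scaling
   of its normal, the optimal solution and the point of the facet are chosen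
   nondeterministically. Facets are identified with their point sets, so the
   marks of facets that survive an update of the hull are kept. *)
Inductive dd_step (s : dd_state) : 'cV[R]_p -> dd_state -> Prop :=
| dd_explore F lam x y' :
    dd_select s F lam x -> F y' -> dot lam y' = dot lam (outcome R I x) ->
    dd_step s (outcome R I x) (DDState (found s) (explored s `|` [set F]))
| dd_add F lam x y' :
    dd_select s F lam x -> F y' -> dot lam y' <> dot lam (outcome R I x) ->
    dd_step s (outcome R I x)
      (DDState (found s `|` [set outcome R I x]) (explored s)).

Inductive dd_reachable : dd_state -> Prop :=
| dd_reach_init s : dd_initial s -> dd_reachable s
| dd_reach_step s y s' : dd_reachable s -> dd_step s y s' -> dd_reachable s'.

(* Points of [S], and also outcomes computed in iterations that merely mark a
   facet. *)
Definition dd_generates (y : 'cV[R]_p) :=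
  exists s, dd_reachable s /\ (found s y \/ exists s', dd_step s y s').

End DummyDichotomy.

(* Main.v *)
(* Every facet of [conv (S ∪ Y_M)] other than [conv Y_M] contains a point of [S],
   and such a point is positive with coordinate sum below [M]; this forces the
   inward normal of the facet to be positive, so only supported points are
   generated. The bound on the sum is first obtained for nondominated extreme
   points from the choice of [M], and it extends to every supported point by
   perturbing its weight to one with a unique minimizer of at least the same sum.

   If a nondominated extreme point [v] were missing from [S] at termination, some
   weight would separate it strictly from [S ∪ Y_M]. Moving that weight within
   [lam g >= 1 for g in S ∪ Y_M, lam v < 1] until as many constraints as possible
   are tight gives a nondominated facet of the hull that [v] violates. That facet
   has been explored, hence its normal supports [Y]: a contradiction. *)
Require Import Defs.
From mathcomp Require Import all_boot all_order all_algebra.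
From mathcomp Require Import boolp classical_sets cardinality reals.
Import Order.TTheory GRing.Theory Num.Theory.
Local Open Scope classical_set_scope.
Local Open Scope ring_scope.

Set Implicit Arguments.
Unset Strict Implicit.
Unset Printing Implicit Defensive.

(** * Linear functionals, convex hulls and their faces *)

Section Geometry.

Variables (R : realType) (p : nat).
Implicit Types (A G P F V : set 'cV[R]_p) (lam mu v w y z : 'cV[R]_p).

Lemma dotE lam y : dot lam y = \sum_k lam k 0 * y k 0.
Proof. by rewrite /dot mxE; apply: eq_bigr => k _; rewrite mxE. Qed.

Lemma dot0r lam : dot lam 0 = 0.
Proof. by rewrite /dot mulmx0 mxE. Qed.

Lemma dotDl lam mu y : dot (lam + mu) y = dot lam y + dot mu y.
Proof. by rewrite /dot linearD mulmxDl mxE. Qed.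

Lemma dotZl a lam y : dot (a *: lam) y = a * dot lam y.
Proof. by rewrite /dot linearZ -scalemxAl mxE. Qed.

Lemma dotNl lam y : dot (- lam) y = - dot lam y.
Proof. by rewrite -scaleN1r dotZl mulN1r. Qed.

Lemma dotDr lam y z : dot lam (y + z) = dot lam y + dot lam z.
Proof. by rewrite /dot mulmxDr mxE. Qed.

Lemma dotZr a lam y : dot lam (a *: y) = a * dot lam y.
Proof. by rewrite /dot -scalemxAr mxE. Qed.

Lemma dot_sumr (J : finType) lam (w : J -> R) (a : J -> 'cV[R]_p) :
  dot lam (\sum_j w j *: a j) = \sum_j w j * dot lam (a j).
Proof.
rewrite /dot mulmx_sumr summxE; apply: eq_bigr => j _.
by rewrite -scalemxAr mxE.
Qed.

Lemma dot_delta k y : dot (delta_mx k 0) y = y k 0.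
Proof.
rewrite dotE (bigD1 k) //= !mxE !eqxx mul1r big1 ?addr0 // => i ik.
by rewrite mxE (negPf ik) mul0r.
Qed.

Lemma dot_const1 y : dot (const_mx 1) y = \sum_k y k 0.
Proof. by rewrite dotE; apply: eq_bigr => k _; rewrite mxE mul1r. Qed.

Lemma dot_gt0 lam y : (0 < p)%N -> positive lam -> positive y -> 0 < dot lam y.
Proof.
move=> p_gt0 lam_gt0 y_gt0; rewrite dotE (bigD1 (Ordinal p_gt0)) //=.
by rewrite ltr_pwDl ?mulr_gt0 // sumr_ge0 // => k _; rewrite mulr_ge0 // ltW.
Qed.

Lemma dot_lt_dominates lam y z :
  positive lam -> dominates y z -> dot lam y < dot lam z.
Proof.
move=> lam_gt0 [yz neq_yz]; rewrite !dotE.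
have le_k k : lam k 0 * y k 0 <= lam k 0 * z k 0 by rewrite ler_pM2l.
have [k yk] : exists k, y k 0 <> z k 0.
  apply/existsNP => eq_yz; apply: neq_yz; apply/colP => k; exact: eq_yz.
rewrite (bigD1 k) //= [ltRHS](bigD1 k) //= ltr_leD ?ler_sum //.
by rewrite ltr_pM2l // lt_neqAle yz andbT; apply/eqP.
Qed.

Lemma argmin_nondominated Q lam y :
  positive lam -> Q y -> (forall z, Q z -> dot lam y <= dot lam z) ->
  nondominated Q y.
Proof.
move=> lam_gt0 Qy le_y; split=> // -[z [/le_y le_yz /(dot_lt_dominates lam_gt0)]].
by rewrite ltNge le_yz.
Qed.

Lemma conv_sub A y : A y -> conv A y.
Proof.
move=> Ay; exists 1%N, (fun=> 1), (fun=> y).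
by split=> //; rewrite ?big_ord1 // scale1r.
Qed.

(** Terms of zero weight may use points outside [A]: the witness replaces them by a point of nonzero
    weight, which exists because the weights sum to 1. *)
Lemma conv_intro (J : finType) A (w : J -> R) (a : J -> 'cV[R]_p) :
  (forall j, w j != 0 -> A (a j)) -> (forall j, 0 <= w j) -> \sum_j w j = 1 ->
  conv A (\sum_j w j *: a j).
Proof.
move=> Aa w_ge0 w1.
have [j0 wj0] : exists j, w j != 0.
  apply/not_existsP => w0; have := oner_eq0 R; rewrite -w1 big1 ?eqxx // => j _.
  by apply/eqP/negPn/negP/w0.
exists #|J|, (fun i => w (enum_val i)),
  (fun i => if w (enum_val i) != 0 then a (enum_val i) else a j0).
split=> // [i||].
- by case: ifP => [/Aa|_] //; apply: Aa.
- by rewrite -(big_enum_val (A := predT)) /= -w1; apply: eq_bigl.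
- transitivity (\sum_(i < #|J|) w (enum_val i) *: a (enum_val i)).
    by rewrite -(big_enum_val (A := predT) (fun j => w j *: a j)); apply: eq_bigl.
  by apply: eq_bigr => i _; case: eqP => //= ->; rewrite !scale0r.
Qed.

Lemma conv_dot_ge A lam c y :
  (forall z, A z -> c <= dot lam z) -> conv A y -> c <= dot lam y.
Proof.
move=> geA [k [w [a [Aa w_ge0 w1 ->]]]]; rewrite dot_sumr.
rewrite -[leLHS]mul1r -w1 mulr_suml ler_sum // => i _.
by rewrite ler_wpM2l // geA.
Qed.

Lemma conv_mono A P : A `<=` P -> conv A `<=` conv P.
Proof.
by move=> AP y [k [w [a [Aa ? ? ?]]]]; exists k, w, a; split=> // i; apply/AP.
Qed.

(** The terms [w j * (dot lam (a j) - c)] are nonnegative and sum to zero, so each of them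
    vanishes. *)
Lemma face_support (J : finType) lam c (w : J -> R) (a : J -> 'cV[R]_p) :
  (forall j, w j != 0 -> c <= dot lam (a j)) ->
  (forall j, 0 <= w j) -> \sum_j w j = 1 ->
  dot lam (\sum_j w j *: a j) = c ->
  forall j, w j != 0 -> dot lam (a j) = c.
Proof.
move=> ge_c w_ge0 w1 eq_c.
have sum0 : \sum_j w j * (dot lam (a j) - c) = 0.
  under eq_bigr do rewrite mulrBr.
  by rewrite sumrB -dot_sumr eq_c -mulr_suml w1 mul1r subrr.
have ge0 j : 0 <= w j * (dot lam (a j) - c).
  have [->|wj] := eqVneq (w j) 0; first by rewrite mul0r.
  by rewrite mulr_ge0 // subr_ge0 ge_c.
move=> j wj; move/eqP: sum0; rewrite psumr_eq0 // => /allP/(_ j).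
by rewrite mem_index_enum mulf_eq0 (negPf wj) subr_eq0 => /(_ isT)/eqP.
Qed.

Lemma conv_face A lam c y :
  (forall z, A z -> c <= dot lam z) -> conv A y -> dot lam y = c ->
  conv (A `&` [set z | dot lam z = c]) y.
Proof.
move=> ge_c [k [w [a [Aa w_ge0 w1 ->]]]] eq_c; apply: conv_intro => // i wi.
by split=> //=; apply: (face_support (w := w)) wi => // j _; apply: ge_c.
Qed.

Lemma conv1 y : conv [set y] = [set y].
Proof.
apply/seteqP; split=> [z [k [w [a [/= ay _ w1 ->]]]]|z ->]; last exact: conv_sub.
by under eq_bigr do rewrite ay; rewrite -scaler_suml w1 scale1r.
Qed.

Lemma conv_nonempty A y : conv A y -> exists z, A z.
Proof.
move=> [[|k] [w [a [Aa _ w1 _]]]]; last by exists (a ord0).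
by move: w1; rewrite big_ord0 => /esym/eqP; rewrite oner_eq0.
Qed.

(** By [conv_face], the face consisting of [v] alone is spanned by points of [A] on it, so one of
    these is [v]. *)
Lemma vertex_conv_mem A v : vertex (conv A) v -> A v.
Proof.
move=> [lam [c [ge_c Fv]]].
have [Cv lamv] : [set y | conv A y /\ dot lam y = c] v by rewrite -Fv.
have [z [Az lamz]] := conv_nonempty
  (conv_face (fun z Az => ge_c z (conv_sub Az)) Cv lamv).
suff: [set v] z by move=> <-.
by rewrite Fv; split=> //; exact: conv_sub.
Qed.

Lemma finite_family G : finite_set G -> exists N (g : 'I_N -> 'cV[R]_p), G = range g.
Proof.
move=> /finite_seqP[s ->]; exists (size s), (fun i => s`_i).
apply/seteqP; split=> [y /= ys|_ [i _ <-] /=]; last by rewrite mem_nth.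
have lt_ys : (index y s < size s)%N by rewrite index_mem.
by exists (Ordinal lt_ys); rewrite //= nth_index.
Qed.

(** * Minimizers over finite sets and perturbation of weights *)

Definition argmin V lam : set 'cV[R]_p :=
  [set v | V v /\ forall w, V w -> dot lam v <= dot lam w].

Lemma argmin_exists V v lam : finite_set V -> V v -> exists w, argmin V lam w.
Proof.
move=> /finite_family[N [g ->]] [i _ _].
case: (arg_minP (fun j => dot lam (g j)) (erefl (xpredT i))) => j _ le_j.
by exists (g j); split=> [|_ [k _ <-]]; [exists j | exact: le_j].
Qed.

Lemma argmin1_vertex V lam v : argmin V lam = [set v] -> vertex (conv V) v.
Proof.
move=> Vv; have [Av le_v] : argmin V lam v by rewrite Vv.
exists lam, (dot lam v); split; first by move=> y; apply: conv_dot_ge.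
apply/seteqP; split=> [_ -> /=|y [Cy lamy]]; first by split=> //; apply: conv_sub.
rewrite -conv1; have := conv_face le_v Cy lamy.
by apply: conv_mono => z [Az lamz]; rewrite -Vv; split=> // u; rewrite lamz => /le_v.
Qed.

Lemma small_perturbation (J : finType) (a b : J -> R) :
  (forall j, 0 < a j) -> exists t, 0 < t /\ forall j, 0 < a j + t * b j.
Proof.
move=> a_gt0; have b1_gt0 j : 0 < 1 + `|b j| by rewrite ltr_pwDl.
(* The initial value 1 keeps the minimum positive for empty [J]; the 1 in each denominator leaves a
   slack of at least [t] in the inequality for [j]. *)
exists (\big[Order.min/1]_j (a j / (1 + `|b j|))).
set t := \big[_/_]_j _; have t_gt0 : 0 < t.
  by apply: lt_bigmin => // j _; rewrite divr_gt0.
split=> // j; have : t <= a j / (1 + `|b j|) by rewrite /t bigmin_le_cond.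
rewrite ler_pdivlMr // mulrDr mulr1 => le_t.
have : - (t * `|b j|) <= t * b j.
  by rewrite -mulrN ler_pM2l // lerNl ler_normr lexx orbT.
move=> le_b; rewrite -[ltLHS](subrr (t * `|b j|)) ltr_leD //.
by rewrite (lt_le_trans _ le_t) // ltrDr.
Qed.

(* Lexicographic minimization: first [lam], then [mu]. *)
Lemma argmin_perturbation V lam mu : finite_set V -> positive lam ->
  exists lam', positive lam' /\ argmin V lam' `<=` argmin (argmin V lam) mu.
Proof.
move=> /finite_family[N [g ->]] lam_gt0.
(* Finitely many strict inequalities must survive the perturbation: positivity of each component of
   [lam], and each strict comparison of two points under [lam]. For other pairs the value 1 is a
   placeholder that keeps [a] positive. *)
pose a (j : 'I_p + 'I_N * 'I_N) := match j with
  | inl k => lam k 0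
  | inr (i, j) => if dot lam (g i) < dot lam (g j)
                  then dot lam (g j) - dot lam (g i) else 1
  end.
pose b (j : 'I_p + 'I_N * 'I_N) := match j with
  | inl k => mu k 0 | inr (i, j) => dot mu (g j) - dot mu (g i) end.
have [|t [t_gt0 ab_gt0]] := @small_perturbation _ a b.
  by case=> [k|[i j]] //=; case: ifP => // ij; rewrite subr_gt0.
exists (lam + t *: mu); split=> [k|].
  by have := ab_gt0 (inl k); rewrite /= !mxE.
have strict i j : dot lam (g i) < dot lam (g j) ->
    dot (lam + t *: mu) (g i) < dot (lam + t *: mu) (g j).
  move=> ij; have := ab_gt0 (inr (i, j)); rewrite /= ij mulrBr addrACA -opprD.
  by rewrite subr_gt0 !dotDl !dotZl.
move=> v [[i _ <-{v}] le_i].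
have min_i : argmin (range g) lam (g i).
  split=> [|_ [j _ <-]]; first by exists i.
  by rewrite leNgt; apply/negP => /strict; rewrite ltNge le_i //; exists j.
split=> // _ [[j _ <-] le_j].
have := le_i (g j); rewrite !dotDl !dotZl.
have -> : dot lam (g i) = dot lam (g j).
  apply/eqP; rewrite eq_le le_j ?andbT; last by exists i.
  by apply: min_i.2; exists j.
by rewrite lerD2l ler_pM2l //; apply; exists j.
Qed.

(** Ties are broken by perturbing towards one unit vector after another; in the end all minimizers
    agree in every coordinate. *)
Lemma argmin_unique V v lam : finite_set V -> V v -> positive lam ->
  exists lam' w,
    [/\ positive lam', argmin V lam' = [set w] & argmin V lam w].
Proof.
move=> finV Vv lam_gt0.
have [lam' [lam'_gt0 sub_lam' eq_lam']] : exists lam', [/\ positive lam',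
    argmin V lam' `<=` argmin V lam
  & forall k, k \in enum 'I_p -> forall y z, argmin V lam' y ->
    argmin V lam' z -> y k 0 = z k 0].
  elim: (enum 'I_p) => [|k s [mu [mu_gt0 sub_mu eq_mu]]]; first by exists lam; split.
  have [mu' [mu'_gt0 sub_mu']] :=
    argmin_perturbation (delta_mx k 0) finV mu_gt0.
  exists mu'; split=> // [y /sub_mu'[/sub_mu]|j] //.
  rewrite inE => /orP[/eqP->|js] y z /sub_mu'[my le_y] /sub_mu'[mz le_z].
    have := le_z _ my; have := le_y _ mz; rewrite !dot_delta => yz zy.
    by apply: le_anti; rewrite yz.
  exact: eq_mu.
have [w min_w] := argmin_exists lam' finV Vv.
exists lam', w; split=> //; last exact: sub_lam'.
apply/seteqP; split=> [y min_y|_ -> //].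
by apply/colP => k; apply: eq_lam'; rewrite ?mem_enum.
Qed.

(** * Affine independence and dimension bounds *)

Section AffineIndependence.

Definition cons_point n x (a : 'I_n -> 'cV[R]_p) (i : 'I_n.+1) :=
  if unlift ord0 i is Some j then a j else x.

Lemma cons_point0 n x (a : 'I_n -> 'cV[R]_p) : cons_point x a ord0 = x.
Proof. by rewrite /cons_point unlift_none. Qed.

Lemma cons_pointS n x (a : 'I_n -> 'cV[R]_p) i :
  cons_point x a (lift ord0 i) = a i.
Proof. by rewrite /cons_point liftK. Qed.

Lemma cons_point_mem P n x (a : 'I_n -> 'cV[R]_p) :
  P x -> (forall i, P (a i)) -> forall i, P (cons_point x a i).
Proof. by move=> Px Pa i; rewrite /cons_point; case: unliftP. Qed.

(** Applying [lam] to an affine relation, and subtracting [c] times the sum of its coefficients,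
    isolates the coefficient of the point [x] off the hyperplane. *)
Lemma cons_point_affinely_independent lam c n x (a : 'I_n -> 'cV[R]_p) :
  (forall i, dot lam (a i) = c) -> dot lam x <> c ->
  affinely_independent a -> affinely_independent (cons_point x a).
Proof.
move=> lam_a lam_x indep_a w; rewrite !big_ord_recl cons_point0.
under [X in _ *: _ + X]eq_bigr do rewrite cons_pointS.
move=> w0 wa0.
have w_0 : w ord0 = 0.
  have /eqP := congr1 (dot lam) wa0; rewrite dot0r dotDr dotZr dot_sumr.
  under eq_bigr do rewrite lam_a.
  rewrite -mulr_suml (canRL (addKr _) w0) addr0 mulNr -mulrBr mulf_eq0 subr_eq0.
  by case/orP => /eqP.
move: w0 wa0; rewrite w_0 scale0r !add0r => w0 wa0 i.
by case: (unliftP ord0 i) => [j ->|-> //]; apply: (indep_a (fun j => w (lift ord0 j))).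
Qed.

(** Appending a coordinate 1 to each point turns affine independence into linear independence of the
    rows of [B], which has [p + 1] columns. *)
Lemma affinely_independent_le e (a : 'I_e.+1 -> 'cV[R]_p) :
  affinely_independent a -> (e <= p)%N.
Proof.
move=> indep_a; rewrite leqNgt; apply/negP => lt_pe.
pose B : 'M[R]_(e.+1, p + 1) := row_mx (\matrix_(i, k) a i k 0) (const_mx 1).
suff /eqnP rankB : row_free B.
  by have := rank_leq_col B; rewrite rankB addn1 ltnS leqNgt lt_pe.
apply: inj_row_free => w; rewrite mul_mx_row => /eqP.
rewrite row_mx_eq0 => /andP[/eqP wa /eqP w1].
apply/rowP => i; rewrite mxE; apply: (indep_a (w 0)) i.
  have /rowP/(_ 0) := w1; rewrite !mxE => {2}<-.
  by apply: eq_bigr => i _; rewrite mxE mulr1.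
apply/colP => k; have /rowP/(_ k) := wa; rewrite !mxE summxE => {2}<-.
by apply: eq_bigr => i _; rewrite !mxE.
Qed.

(** The hyperplane misses the origin, which can therefore be adjoined to the family. *)
Lemma affinely_independent_hyperplane_lt lam e (a : 'I_e.+1 -> 'cV[R]_p) :
  (forall i, dot lam (a i) = 1) -> affinely_independent a -> (e < p)%N.
Proof.
move=> lam_a indep_a; apply: (affinely_independent_le (a := cons_point 0 a)).
apply: cons_point_affinely_independent lam_a _ indep_a.
by rewrite dot0r => /esym/eqP; rewrite oner_eq0.
Qed.

End AffineIndependence.

End Geometry.

(** * Facets obtained from tight constraints *)

Section Facets.

(** The last hypothesis says that the tight points span the space. A basis chosen among them gives
    the face dimension at least [p - 1], and lying on a hyperplane off the origin gives at most
    that. *)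
Lemma tight_facet (R : realType) (p N : nat) (g : 'I_N -> 'cV[R]_p) P
    (lam : 'cV[R]_p) (a : 'I_p.+1 -> 'cV[R]_p) :
  (0 < p)%N -> (forall j, P (g j)) -> (forall y, P y -> 1 <= dot lam y) ->
  (forall i, P (a i)) -> affinely_independent a ->
  (forall del : 'cV[R]_p,
     (forall j, dot lam (g j) = 1 -> dot del (g j) = 0) -> del = 0) ->
  facet P [set y | P y /\ dot lam y = 1].
Proof.
case: p => // p in g P lam a * => _ Pg ge1 Pa indep_a tight_full.
split; first by exists lam, 1.
exists p; split; split.
- by exists a.
- by move=> e b _; apply: affinely_independent_le.
(* Rows of non-tight points are set to zero, so an invertible selection of rows uses tight points
   only. *)
- pose T : 'M[R]_(N, p.+1) :=
    \matrix_(j, k) if dot lam (g j) == 1 then g j k 0 else 0.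
  have fullT : row_full T.
    rewrite /row_full -mxrank_tr; apply: inj_row_free => del delT.
    apply: trmx_inj; rewrite trmx0; apply: tight_full => j tight_j.
    have /rowP/(_ j) := delT; rewrite !mxE dotE => {2}<-.
    by apply: eq_bigr => k _; rewrite !mxE tight_j eqxx.
  pose f := fullrankfun fullT; have unitT := fullrowsub_unit fullT.
  have injT (u : 'rV_p.+1) : u *m rowsub f T = 0 -> u = 0.
    by move=> uT; rewrite -(mulmxK unitT u) uT mul0mx.
  have tight_f i : dot lam (g (f i)) = 1.
    apply/eqP/negPn/negP => /negPf not_tight.
    have : (delta_mx 0 i : 'rV_p.+1) *m rowsub f T = 0.
      by rewrite -rowE; apply/rowP => k; rewrite !mxE not_tight.
    move=> /injT/rowP/(_ i); rewrite !mxE !eqxx /=.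
    by move=> /eqP; rewrite oner_eq0.
  exists (g \o f); split=> [i|w _ wg]; first by split=> //=.
  have : (\row_i w i) *m rowsub f T = 0.
    apply/rowP => k; have /colP/(_ k) := wg; rewrite summxE !mxE => {2}<-.
    by apply: eq_bigr => i _; rewrite !mxE tight_f eqxx.
  by move=> /injT/rowP w0 i; have := w0 i; rewrite !mxE.
- move=> e b Fb /(affinely_independent_hyperplane_lt _); apply => i.
  exact: (Fb i).2.
Qed.

(** Induction on the number of non-tight constraints. While the tight points do not span, [lam]
    moves along a direction vanishing on them and not increasing the value at [v]; the blocking
    hypothesis ensures that a further constraint becomes tight. *)
Lemma exists_tight (R : realType) (p N : nat) (g : 'I_N -> 'cV[R]_p)
    (lam v : 'cV[R]_p) :
  (forall j, 1 <= dot lam (g j)) -> dot lam v < 1 ->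
  (forall del : 'cV[R]_p, del != 0 -> dot del v <= 0 -> exists j, dot del (g j) < 0) ->
  exists lam', [/\ forall j, 1 <= dot lam' (g j), dot lam' v < 1
    & forall del : 'cV[R]_p,
        (forall j, dot lam' (g j) = 1 -> dot del (g j) = 0) -> del = 0].
Proof.
pose tight mu := [set j | dot mu (g j) == 1]%SET.
have [k] := ubnP (N - #|tight lam|)%N.
elim: k lam => // k IHk lam le_k ge1 lt1 blocked.
have [?|/existsNP[del /not_implyP[tight0 /eqP del0]]] := pselect (forall del : 'cV[R]_p,
  (forall j, dot lam (g j) = 1 -> dot del (g j) = 0) -> del = 0); first by exists lam.
(* Vanishing on the tight points is preserved under negation, so the sign of [del] is free. *)
wlog le_v : del tight0 del0 / dot del v <= 0.
  move=> WL; have [|/ltW v_ge0] := leP (dot del v) 0; first exact: WL.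
  apply: (WL (- del)); rewrite ?oppr_eq0 ?dotNl ?oppr_le0 // => j /tight0.
  by rewrite dotNl => ->; rewrite oppr0.
have [j0 lt0] := blocked _ del0 le_v.
(* Ratio test: [t j] is the step length at which constraint [j] becomes tight, and the smallest one
   keeps all constraints satisfied. *)
pose t j := (dot lam (g j) - 1) / - dot del (g j).
case: (arg_minP t (lt0 : (fun j => dot del (g j) < 0) j0)) => j1 lt1j min_j1.
have t_ge0 : 0 <= t j1 by rewrite divr_ge0 ?subr_ge0 // oppr_ge0 ltW.
have dotE' y : dot (lam + t j1 *: del) y = dot lam y + t j1 * dot del y.
  by rewrite dotDl dotZl.
apply: (IHk (lam + t j1 *: del)) => // [|j|].
- rewrite -ltnS; apply: leq_trans le_k; rewrite ltnS.
  suff lt_tight : (#|tight lam| < #|tight (lam + t j1 *: del)%R|)%N.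
    rewrite ltn_sub2l // (leq_trans lt_tight) //.
    by rewrite -[leqRHS]card_ord max_card.
  apply: proper_card; apply/properP; split.
    apply/fintype.subsetP => j; rewrite !inE dotE' => /eqP tj.
    by rewrite tj tight0 // mulr0 addr0.
  exists j1; rewrite !inE ?dotE' /t.
    by rewrite invrN mulrN mulNr divfK ?ltr0_neq0 // subKr.
  by apply/eqP => /tight0/eqP; rewrite lt_eqF.
- rewrite dotE'; have [ge0|lt0j] := leP 0 (dot del (g j)).
    by rewrite (le_trans (ge1 j)) // lerDl mulr_ge0.
  have := min_j1 j lt0j; rewrite {2}/t ler_pdivlMr ?oppr_gt0 // mulrN.
  by rewrite lerBrDr -lerBrDl opprK addrC [t _ * _ + _]addrC.
- by rewrite dotE' (le_lt_trans _ lt1) // gerDl mulr_ge0_le0.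
Qed.

End Facets.

(** * The hull of found points and dummy points *)

Section DummyPoints.

Variables (R : realType) (p : nat) (M : R).
Hypotheses (p_ge2 : (2 <= p)%N) (M_gt0 : 0 < M).
Implicit Types (S Y F : set 'cV[R]_p) (lam v y : 'cV[R]_p).

Let dummies := @dummies R p M.

Lemma dot_dummy lam q : dot lam (dummy M q) = M * lam q 0.
Proof.
rewrite dotZr dotE (bigD1 q) //= !mxE !eqxx mulr1 big1 ?addr0 // => k kq.
by rewrite mxE (negPf kq) mulr0.
Qed.

Lemma sum_dummy q : dot (const_mx 1) (@dummy R p M q) = M.
Proof. by rewrite dot_dummy mxE mulr1. Qed.

Lemma positive_neq_dummy v q : positive v -> v <> dummy M q.
Proof.
move=> v_gt0 vq; have [r rq] : exists r : 'I_p, r != q.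
  case: p p_ge2 q {v v_gt0 vq} => [|[|p']] // _ q.
  have [->|nq] := eqVneq q ord0; first by exists ord_max.
  by exists ord0; rewrite eq_sym.
have := v_gt0 r; rewrite vq -dot_delta dot_dummy mxE [q == r]eq_sym (negPf rq).
by rewrite mulr0 ltxx.
Qed.

Lemma dummy_affinely_independent : affinely_independent (@dummy R p M).
Proof.
move=> w _ w0 q; have := congr1 (dot (delta_mx q 0)) w0.
rewrite dot0r dot_sumr (bigD1 q) //= big1 => [|r rq].
  rewrite addr0 dot_dummy mxE !eqxx mulr1 => /eqP.
  by rewrite mulf_eq0 (gt_eqF M_gt0) orbF => /eqP.
by rewrite dot_dummy mxE (negPf rq) mulr0 mulr0.
Qed.

(** Weighting the inequalities [dot lam v <= M * lam q 0] by [v q 0] and summing bounds the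
    coordinate sum by [M]. Equality would make [v] a convex combination of all dummies with positive
    weights, so the face of the vertex would contain dummies. *)
Lemma extreme_sum_lt Y v : positive v ->
  nondominated_extreme (Y `|` dummies) v -> dot (const_mx 1) v < M.
Proof.
move=> v_gt0 [[_ [lam [lam_gt0 le_v]]] [mu [c [ge_c Fv]]]].
have p_gt0 : (0 < p)%N by apply: leq_trans p_ge2.
have le_M : dot (const_mx 1) v <= M.
  rewrite -(ler_pM2r (dot_gt0 p_gt0 lam_gt0 v_gt0)) dot_const1 mulr_suml.
  rewrite [in leRHS]dotE mulr_sumr ler_sum // => q _.
  rewrite mulrA mulrC ler_pM2r // -dot_dummy le_v //.
  by right; exists q.
rewrite lt_neqAle le_M andbT; apply/eqP => sum_v.
pose q0 := Ordinal p_gt0; pose w q := v q 0 / M.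
have w_gt0 q : 0 < w q by rewrite divr_gt0.
have v_eq : v = \sum_q w q *: dummy M q.
  apply/colP => k; rewrite -[RHS]dot_delta dot_sumr (bigD1 k) //= big1.
    by rewrite addr0 dot_dummy mxE !eqxx mulr1 divfK ?gt_eqF.
  by move=> q qk; rewrite dot_dummy mxE (negPf qk) !mulr0.
have dummy_conv q : conv (Y `|` dummies) (dummy M q).
  by apply: conv_sub; right; exists q.
have : [set v] (dummy M q0).
  rewrite Fv; split; first exact: dummy_conv.
  apply: (face_support (w := w)) => [q _|q|||].
  - exact/ge_c/dummy_conv.
  - exact/ltW.
  - by rewrite -mulr_suml -dot_const1 sum_v divff ?gt_eqF.
  - have : [set v] v by [].
    by rewrite -v_eq Fv => -[].
  - exact/lt0r_neq0/w_gt0.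
by move=> /esym; apply: positive_neq_dummy.
Qed.

Lemma supported_sum_lt Y y :
  polytope (conv Y) -> (forall z, Y z -> positive z) -> large_enough M Y ->
  supported_nondominated Y y -> dot (const_mx 1) y < M.
Proof.
move=> [V [finV convY]] Y_gt0 [_ extremeY] [[Yy _] [lam [lam_gt0 le_y]]].
have Vy : conv V y by rewrite -convY; apply: conv_sub.
have le_V z : V z -> dot lam y <= dot lam z.
  by move=> Vz; apply: (conv_dot_ge le_y); rewrite convY; apply: conv_sub.
have Ay : conv (argmin V lam) y.
  have := conv_face le_V Vy erefl; apply: conv_mono => z [Vz lamz].
  by split=> // u /le_V; rewrite lamz.
(* This perturbation selects the minimizers of largest coordinate sum; [y], a convex combination of
   minimizers of [lam], has no larger sum. *)
have [mu [mu_gt0 sub_mu]] := argmin_perturbation (- const_mx 1) finV lam_gt0.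
have [z Vz] := conv_nonempty Vy.
have [mu' [v [mu'_gt0 argmin_v /sub_mu[lam_v max_v]]]] :=
  argmin_unique finV Vz mu_gt0.
have vertex_v : vertex (conv Y) v by rewrite convY; apply: argmin1_vertex argmin_v.
have Yv := vertex_conv_mem vertex_v.
have le_v u : Y u -> dot mu' v <= dot mu' u.
  move=> Yu; have [_ min_v] : argmin V mu' v by rewrite argmin_v.
  by apply: (conv_dot_ge min_v); rewrite -convY; apply: conv_sub.
have extreme_v : nondominated_extreme Y v.
  split=> //; split; last by exists mu'.
  exact: argmin_nondominated mu'_gt0 Yv le_v.
rewrite (le_lt_trans _ (extreme_sum_lt (Y_gt0 _ Yv) (extremeY _ extreme_v))) //.
by rewrite -lerN2 -!dotNl (conv_dot_ge max_v).
Qed.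

(* If no found point lay on the facet, it could miss a dummy point as well, and
   adjoining that dummy and a found point to an affine basis of the facet would
   exceed the dimension of the hull by one. *)
Lemma facet_found_point S F s0 :
  S s0 -> (forall s, S s -> dot (const_mx 1) s < M) ->
  facet (dd_hull M S) F -> F <> conv dummies -> exists s, S s /\ F s.
Proof.
move=> Ss0 S_lt [[lam [c [ge_c FE]]] [d [[_ dimP] [[a [Fa indep_a]] _]]]] Fneq.
apply/not_existsP => noS.
have hull_dummy q : dd_hull M S (dummy M q).
  by apply: conv_sub; right; exists q.
have F_dummies y : F y ->
    conv [set z | (exists q, z = dummy M q) /\ F z] y.
  rewrite FE => -[Py lamy].
  have := conv_face (fun z Az => ge_c z (conv_sub Az)) Py lamy.
  apply: conv_mono => z [[Sz|[q _ <-]] lamz]; last by split=> //=; exists q.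
  case: (noS z); split=> //; rewrite FE; split=> //.
  by apply: conv_sub; left.
have [all_F|/existsNP[q notFq]] := pselect (forall q, F (dummy M q)).
  apply: Fneq; apply/seteqP; split=> y.
    by move=> /F_dummies; apply: conv_mono => _ [[q ->] _]; exists q.
  move=> Dy; rewrite FE; split.
    by apply: conv_mono Dy => z Dz; right.
  have [k [w [b [Db _ w1 ->]]]] := Dy; rewrite dot_sumr.
  under eq_bigr => i _.
    have -> : dot lam (b i) = c.
      by have [r _ <-] := Db i; have := all_F r; rewrite FE => -[].
    over.
  by rewrite -mulr_suml w1 mul1r.
(* [F] is spanned by dummies other than the missed one, so coordinate [q] vanishes on it. *)
have F_q y : F y -> dot (delta_mx q 0) y = 0.
  move=> /F_dummies[k [w [b [Db _ _ ->]]]]; rewrite dot_sumr big1 // => i _.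
  have [[r ->] Fr] := Db i; rewrite dot_dummy mxE.
  by case: eqP => [rq|_]; [rewrite rq in Fr | rewrite !mulr0].
have F_M y : F y -> dot (const_mx 1) y = M.
  move=> /F_dummies[k [w [b [Db _ w1 ->]]]]; rewrite dot_sumr.
  under eq_bigr => i _.
    by have [[r ->] _] := Db i; rewrite sum_dummy; over.
  by rewrite -mulr_suml w1 mul1r.
pose b := cons_point (dummy M q) a.
have sum_b i : dot (const_mx 1) (b i) = M.
  move: i; apply: (cons_point_mem (P := fun y => dot (const_mx 1) y = M)) => [|i].
    exact: sum_dummy.
  exact/F_M/Fa.
(* The [d.+1] points of [a] and the two adjoined points are [d.+3] affinely independent points of a
   hull of dimension [d.+1]. *)
have : (d.+2 <= d.+1)%N; last by rewrite ltnn.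
apply: (dimP d.+2 (cons_point s0 b)).
  apply: cons_point_mem => [|i]; first by apply: conv_sub; left.
  apply: (cons_point_mem (P := dd_hull M S)) => // j.
  by have := Fa j; rewrite FE => -[].
apply: (cons_point_affinely_independent sum_b) => [/eqP|].
  by rewrite lt_eqF ?S_lt.
apply: (cons_point_affinely_independent (fun i => F_q _ (Fa i))) => // /eqP.
by rewrite dot_dummy mxE !eqxx mulr1 gt_eqF.
Qed.

(** For the smallest component [lam k 0] and a found point [s] on the facet, [lam k 0] times the
    coordinate sum of [s] is at most [c], hence at most [M * lam k 0]. A negative component
    contradicts the sum being below [M]; a zero one forces [lam] to vanish. *)
Lemma facet_normal_positive S F lam s0 :
  S s0 -> (forall s, S s -> positive s /\ dot (const_mx 1) s < M) ->
  facet (dd_hull M S) F -> F <> conv dummies ->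
  inward_normal (dd_hull M S) F lam -> positive lam.
Proof.
move=> Ss0 S_ok facetF Fneq [lam0 [c [F_c ge_c]]].
have [s [Ss Fs]] :=
  facet_found_point Ss0 (fun s Ss => (S_ok s Ss).2) facetF Fneq.
have [s_gt0 s_lt] := S_ok s Ss; have lam_s := F_c s Fs.
have le_dummy q : c <= M * lam q 0.
  by rewrite -dot_dummy ge_c //; apply: conv_sub; right; exists q.
have p_gt0 : (0 < p)%N by apply: leq_trans p_ge2.
have [k _ min_k] := arg_minP (fun k => lam k 0) (erefl (xpredT (Ordinal p_gt0))).
suff lamk_gt0 : 0 < lam k 0 by move=> q; rewrite (lt_le_trans lamk_gt0) ?min_k.
have ge_k : lam k 0 * dot (const_mx 1) s <= c.
  rewrite -lam_s dot_const1 dotE mulr_sumr ler_sum // => q _.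
  by rewrite ler_pM2r ?min_k.
rewrite ltNge; apply/negP; rewrite le_eqVlt => /orP[/eqP lamk0|lamk_lt0].
  have lam_ge0 q : 0 <= lam q 0 by rewrite -lamk0 min_k.
  have /eqP : c = 0.
    have := le_dummy k; rewrite lamk0 mulr0 => c_le0.
    by apply: le_anti; rewrite c_le0; move: ge_k; rewrite lamk0 mul0r.
  rewrite -lam_s dotE psumr_eq0 => [/allP lams0|q _]; last by rewrite mulr_ge0 // ltW.
  move/eqP: lam0; apply; apply/colP => q; rewrite mxE.
  have := lams0 q; rewrite mem_index_enum mulf_eq0 (gt_eqF (s_gt0 q)) orbF.
  by move=> /(_ isT)/eqP.
have := le_trans ge_k (le_dummy k).
by rewrite mulrC ler_nM2r // leNgt s_lt.
Qed.

(** The last clause holds because the tight points span; it lets any normal recorded for this facet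
    be compared with [lam]. *)
Lemma missing_extreme_facet S Y v s0 :
  finite_set S -> S `<=` Y -> S s0 ->
  (forall s, S s -> positive s /\ dot (const_mx 1) s < M) ->
  positive v -> nondominated_extreme (Y `|` dummies) v -> ~ S v ->
  exists lam, let F := [set y | dd_hull M S y /\ dot lam y = 1] in
    [/\ positive lam, dot lam v < 1, facet (dd_hull M S) F,
        nondominated_face (dd_hull M S) F
      & forall lam' c, (forall y, F y -> dot lam' y = c) -> lam' = c *: lam].
Proof.
move=> finS SY Ss0 S_ok v_gt0 [[_ [lam0 [lam0_gt0 le_v]]] [mu [c [ge_c Fv]]]] notSv.
have p_gt0 : (0 < p)%N by apply: leq_trans p_ge2.
have mu_v : dot mu v = c by have : [set v] v by []; rewrite Fv => -[].
pose G := S `|` dummies.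
have finG : finite_set G by rewrite finite_setU; split=> //; apply: finite_image.
have GY : G `<=` Y `|` dummies by move=> y [/SY|]; [left|right].
have notGv : ~ G v by case=> // -[q _ /esym]; apply: positive_neq_dummy.
have finV : finite_set (v |` G) by rewrite finite_setU; split.
have Vv : (v |` G) v by left.
have min_v : argmin (v |` G) lam0 v.
  by split=> // w [->|/GY/le_v].
have [lam1 [lam1_gt0 sub_lam1]] := argmin_perturbation mu finV lam0_gt0.
(* Ties of [lam0] at [v] are broken by [mu], which exposes [v] as a vertex. *)
have lt_lam1 y : G y -> dot lam1 v < dot lam1 y.
  have argmin_v u : argmin (v |` G) lam1 u -> u = v.
    move=> min_u; have [[[//|Gu] _] /(_ v min_v) le_u] := sub_lam1 u min_u.
    have Cu : conv (Y `|` dummies) u by apply/conv_sub/GY.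
    suff : [set v] u by [].
    rewrite Fv; split=> //; apply: le_anti.
    by rewrite ge_c // -mu_v le_u.
  move=> Gy; rewrite ltNge; apply/negP => le_y.
  have [u min_u] := argmin_exists lam1 finV Vv.
  have uv := argmin_v _ min_u; rewrite uv in min_u.
  have yv : y = v.
    apply: argmin_v; split; first by right.
    by move=> w Vw; rewrite (le_trans le_y) // min_u.2.
  by apply: notGv; rewrite -yv.
have [y0 [Gy0 min_y0]] : exists y, argmin G lam1 y.
  by apply: (@argmin_exists _ _ G s0) => //; left.
have c1_gt0 : 0 < dot lam1 y0.
  exact: lt_trans (dot_gt0 p_gt0 lam1_gt0 v_gt0) (lt_lam1 _ Gy0).
have [N [g Gg]] := finite_family finG.
have g_G j : G (g j) by rewrite Gg; exists j.
(* Dividing by the minimum of [lam1] over [G] normalizes the constraints to right-hand side 1. *)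
have [||del del0 del_v|lam [ge1 lt1 full]] :=
    @exists_tight R p N g ((dot lam1 y0)^-1 *: lam1) v.
- by move=> j; rewrite dotZl mulrC ler_pdivlMr // mul1r min_y0.
- by rewrite dotZl mulrC ltr_pdivrMr // mul1r lt_lam1.
(* An unblocked direction is nonnegative on every dummy, hence in every component; being at most 0
   at the positive point [v], it is zero. *)
- apply/not_existsP => del_ge0; move/eqP: del0; apply.
  have del_ge q : 0 <= del q 0.
    have [j _ gj] : range g (dummy M q) by rewrite -Gg; right; exists q.
    have := del_ge0 j; rewrite gj dot_dummy => /negP; rewrite -leNgt.
    by rewrite pmulr_rge0.
  have /eqP : dot del v = 0.
    apply: le_anti; rewrite del_v dotE sumr_ge0 // => q _.
    by rewrite mulr_ge0 // ltW.
  rewrite dotE psumr_eq0 => [/allP delv0|q _]; last by rewrite mulr_ge0 // ltW.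
  apply/colP => q; rewrite mxE.
  have := delv0 q; rewrite mem_index_enum mulf_eq0 (gt_eqF (v_gt0 q)) orbF.
  by move=> /(_ isT)/eqP.
have ge1_G y : G y -> 1 <= dot lam y by rewrite Gg => -[j _ <-].
have ge1_hull y : dd_hull M S y -> 1 <= dot lam y by apply: conv_dot_ge ge1_G.
have lam_gt0 : positive lam.
  move=> q; have /(lt_le_trans ltr01) : 1 <= dot lam (dummy M q).
    by apply: ge1_G; right; exists q.
  by rewrite dot_dummy pmulr_rgt0.
exists lam => /=; split=> //.
- apply: (tight_facet (g := g) (a := cons_point s0 (dummy M))) => //.
  + by move=> j; apply/conv_sub/g_G.
  + apply: cons_point_mem => [|q]; apply: conv_sub; first by left.
    by right; exists q.
  + apply: (cons_point_affinely_independent sum_dummy).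
      by apply/eqP; rewrite lt_eqF //; apply: (S_ok _ Ss0).2.
    exact: dummy_affinely_independent.
- move=> y [Py lamy]; apply: (argmin_nondominated lam_gt0) => // z /ge1_hull.
  by rewrite lamy.
- move=> lam' c' F_c'; apply/eqP; rewrite -subr_eq0; apply/eqP/full => j tight_j.
  rewrite dotDl dotNl dotZl tight_j mulr1 F_c' ?subrr //; split=> //.
  exact/conv_sub/g_G.
Qed.

End DummyPoints.

(** * Invariant of the algorithm and its consequences *)

Section Algorithm.

Variables (R : realType) (p m n : nat) (I : moilp p m n) (M : R).
Hypotheses (p_ge2 : (2 <= p)%N)
  (ideal_gt0 : exists yI : 'cV[R]_p, ideal_point I yI /\ positive yI)
  (convY_polytope : polytope (conv (outcomes R I)))
  (M_large : large_enough M (outcomes R I)).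

Let Y := outcomes R I.
Let M_gt0 : 0 < M := M_large.1.

Lemma outcomes_positive y : Y y -> positive y.
Proof.
have [yI [idealI yI_gt0]] := ideal_gt0.
by move=> [x Xx <-] k; rewrite (lt_le_trans (yI_gt0 k)) // (idealI k).2.
Qed.

Lemma supported_ok s : supported_nondominated Y s ->
  positive s /\ dot (const_mx 1) s < M.
Proof.
move=> supp_s; split; first by apply: outcomes_positive; have [[]] := supp_s.
exact: supported_sum_lt convY_polytope outcomes_positive M_large supp_s.
Qed.

(** The state stores no normals and the hull changes later, so the certificate refers only to [F]
    and the outcome set. *)
Definition explored_facet (F : set 'cV[R]_p) :=
  exists lam c, [/\ positive lam, forall y, F y -> dot lam y = c
                  & forall y, Y y -> c <= dot lam y].

Definition dd_invariant (s : dd_state R p) :=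
  [/\ finite_set (found s), exists y, found s y,
      found s `<=` [set y | supported_nondominated Y y]
    & explored s `<=` [set F | explored_facet F]].

Lemma select_positive s F lam x :
  dd_invariant s -> dd_select I M s F lam x -> positive lam.
Proof.
move=> [_ [y Sy] supp_S _] [_ [facetF Fneq _] normalF _].
by apply: (facet_normal_positive p_ge2 M_gt0 Sy) normalF => // z /supp_S/supported_ok.
Qed.

Lemma weighted_sum_optimal_supported (lam : 'cV[R]_p) x :
  positive lam -> weighted_sum_optimal I lam x ->
  supported_nondominated Y (outcome R I x).
Proof.
move=> lam_gt0 [Xx le_x].
have le_Y y : Y y -> dot lam (outcome R I x) <= dot lam y.
  by move=> [x' Xx' <-]; apply: le_x.
split; last by exists lam.
by apply: argmin_nondominated lam_gt0 _ le_Y; exists x.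
Qed.

Lemma step_supported s y s' :
  dd_invariant s -> dd_step I M s y s' -> supported_nondominated Y y.
Proof.
move=> inv_s; case=> F lam x y' sel _ _;
  have [_ _ _ /weighted_sum_optimal_supported] := sel;
  by apply; apply: select_positive sel.
Qed.

Lemma step_invariant s y s' :
  dd_invariant s -> dd_step I M s y s' -> dd_invariant s'.
Proof.
move=> inv_s step; have supp_y := step_supported inv_s step.
have [finS [z Sz] supp_S expl_s] := inv_s.
case: step supp_y => F lam x y' sel Fy' eq_y' supp_y; split=> //=.
- by exists z.
- move=> _ [/expl_s //|->].
  have lam_gt0 := select_positive inv_s sel.
  have [_ _ [_ [c [F_c _]]] [_ le_x]] := sel.
  exists lam, c; split=> // _ [x' Xx' <-].
  (* The equality test identifies the level [c] of the facet with the optimal value of the weighted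
     sum problem. *)
  by rewrite -(F_c _ Fy') eq_y' le_x.
- by rewrite finite_setU; split.
- by exists z; left.
- by move=> _ [/supp_S //|->].
Qed.

Lemma reachable_invariant s : dd_reachable I M s -> dd_invariant s.
Proof.
elim=> [_ [y [supp_y ->]]|s' y s'' _ inv step]; last exact: step_invariant step.
by split=> //=; [exists y | move=> _ ->].
Qed.

Lemma generates_supported y :
  dd_generates I M y -> supported_nondominated Y y.
Proof.
move=> [s [/reachable_invariant inv_s [Sy|[s' step]]]].
  by have [_ _ supp_S _] := inv_s; apply: supp_S.
exact: step_supported step.
Qed.

Lemma terminated_extreme s v :
  dd_reachable I M s -> dd_terminated M s -> nondominated_extreme Y v ->
  found s v.
Proof.
move=> /reachable_invariant[finS [s0 Ss0] supp_S expl_s] term_s extreme_v.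
apply: contrapT => notSv.
have Yv : Y v by have [[[]]] := extreme_v.
have [||||lam [lam_gt0 lt1 facetF ndF F_unique]] :=
  @missing_extreme_facet _ _ M p_ge2 M_gt0 (found s) Y v s0 finS _ Ss0 _ _ _ notSv.
- by move=> z /supp_S[[]].
- by move=> z /supp_S/supported_ok.
- exact: outcomes_positive.
- exact: M_large.2 _ extreme_v.
have [lam' [c [lam'_gt0 F_c le_c]]] := expl_s _ (term_s _ facetF ndF).
have lam'E := F_unique _ _ F_c.
have p_gt0 : (0 < p)%N by apply: leq_trans p_ge2.
(* Since [lam'] is [c] times [lam] and both are positive, so is [c]; the recorded bound at [v] then
   reads [c <= c * dot lam v], against [dot lam v < 1]. *)
have c_gt0 : 0 < c.
  have := lam'_gt0 (Ordinal p_gt0).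
  by rewrite lam'E mxE pmulr_lgt0.
have := le_c _ Yv.
by rewrite lam'E dotZl ler_pMr // leNgt lt1.
Qed.

End Algorithm.

Theorem proposition8 (R : realType) (p m n : nat) (I : moilp p m n) (M : R)
    (p_ge2 : (2 <= p)%N)
    (no_simultaneous_min : ~ exists x, simultaneous_minimizer R I x)
    (ideal_gt0 : exists yI : 'cV[R]_p, ideal_point I yI /\ positive yI)
    (convY_polytope : polytope (conv (outcomes R I)))
    (M_large : large_enough M (outcomes R I)) :
  (forall y, dd_generates I M y -> supported_nondominated (outcomes R I) y) /\
  (forall s, dd_reachable I M s -> dd_terminated M s ->
     [set y | nondominated_extreme (outcomes R I) y] `<=` found s).
Proof.
split=> [y|s reach_s term_s v extreme_v]; first exact: generates_supported.
exact: (terminated_extreme p_ge2 ideal_gt0 convY_polytope M_large reach_s).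
Qed.
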